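(* Let $k$ be even and let $\Sigma_{\bm q}\subseteq \mathcal{S}^k(\mathbb{R}^{n+1})$ be the cone of positive $\bm q$-Symmetric tensors. The cone $\Sigma_{\bm q}^*$ dual to $\Sigma_{\bm q}$ with respect to the apolar product is $$\Sigma_{\bm q}^*=\left\{p\in\mathcal{S}^k(\mathbb{R}^{n+1})\mid p(\bm q(\bm\xi))\geq0 \text{ for all }\bm\xi\in\mathbb{S}^{m}\right\}.$$
   Context: Let $m,n,k,h$ be positive integers. $\mathcal{S}^d(\mathbb{R}^{N+1})$ is the space of real homogeneous polynomials (forms) of degree $d$ in $N+1$ variables. Variables are $\bm X=(X_0,\dots,X_n)$ for $\mathcal{S}^k(\mathbb{R}^{n+1})$ and $\bm Z=(Z_0,\dots,Z_m)$ for forms in $m+1$ variables. $\langle \bm v,\bm X\rangle=\sum_i v_iX_i$; $\bm v^{\bm\alpha}=\prod_i v_i^{\alpha_i}$. $\mathbb{S}^m=\{\bm v\in\mathbb{R}^{m+1}:\sum v_i^2=1\}$. Let $\bm q=(q_0,\dots,q_n)$ with $q_i\in\mathcal{S}^h(\mathbb{R}^{m+1})$. $W_{\bm q}:\mathcal{S}^k(\mathbb{R}^{n+1})\to\mathcal{S}^{hk}(\mathbb{R}^{m+1})$ is the linear map $\bm X^{\bm\alpha}\mapsto \bm q(\bm Z)^{\bm\alpha}$. The apolar product on degree $d$ forms is $\langle f,g\rangle_d=\sum_{\bm\alpha}\binom{d}{\bm\alpha}^{-1}f_{\bm\alpha}g_{\bm\alpha}$ (where $f_{\bm\alpha},g_{\bm\alpha}$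 are the monomial coefficients and $\binom{d}{\bm\alpha}=\frac{d!}{\prod\alpha_i!}$), and $A_d$ is the isomorphism $f\mapsto\langle f,\cdot\rangle_d$ onto the dual space. Put $\phi_{\bm q}=A_k^{-1}\circ W_{\bm q}^*\circ A_{hk}$, with $W_{\bm q}^*$ the transpose of $W_{\bm q}$; the $\bm q$-Symmetric tensors are the elements of $\bm q\text{-}\mathrm{Sym}_{k,n+1}:=\mathrm{Im}(\phi_{\bm q})\subseteq\mathcal{S}^k(\mathbb{R}^{n+1})$. A positive $\bm q$-Symmetric decomposition of $p\in \bm q\text{-}\mathrm{Sym}_{k,n+1}$ is an expression $p=\sum_{i=1}^r\lambda_i\langle\bm q(\bm\xi_i),\bm X\rangle^k$ with $r\in\mathbb{N}$, $\lambda_1,\dots,\lambda_r>0$ and $\bm\xi_1,\dots,\bm\xi_r\in\mathbb{R}^{m+1}$ corresponding to different points in $\mathbb{P}^m(\mathbb{R})$. Positive $\bm q$-Symmetric tensors are the $\bm q$-Symmetric tensors admitting a positive $\bm q$-Symmetric decomposition (together with $0$, as elements of a cone). The dual of a cone $C$ in an inner product space $V$ is $C^*=\{v\in V\mid\langle v,w\rangle\ge0\text{ for all }w\in C\}$. *)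

(* Defs.v *)
From HB Require Import structures.
From mathcomp Require Import all_boot all_order all_algebra.
From mathcomp Require Import boolp classical_sets reals.
From mathcomp Require Import mpoly.

Set Implicit Arguments.
Unset Strict Implicit.
Unset Printing Implicit Defensive.

Import Order.TTheory GRing.Theory Num.Theory.

Local Open Scope classical_set_scope.
Local Open Scope ring_scope.

(* Forms of degree d in the N+1 variables X_0, ..., X_N *)
Notation hform R N d := (dhomog N.+1 R d).

Section Apolar.
Variables (R : realType) (N d : nat).

Definition multinomial_coeff (a : 'X_{1..N.+1}) : R :=
  d`!%:R / \prod_(i < N.+1) (a i)`!%:R.

Definition apolar (f g : hform R N d) : R :=
  \sum_(a : 'X_{1..N.+1 < d.+1} | mdeg a == d)
     (multinomial_coeff a)^-1 * f@_a * g@_a.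

Definition apolar_form (f : hform R N d) (g : hform R N d) : R^o := apolar f g.

Fact apolar_form_is_linear f : linear (apolar_form f).
Proof.
move=> c g1 g2; rewrite /apolar_form /apolar scaler_sumr -big_split /=.
apply: eq_bigr => a _; rewrite linearP /= mulrDr; congr (_ + _).
by rewrite mulrCA.
Qed.
HB.instance Definition _ f :=
  GRing.isLinear.Build R (hform R N d) R^o _ (apolar_form f)
    (apolar_form_is_linear f).

Definition apolar_dual (f : hform R N d) : 'Hom(hform R N d, R^o) :=
  linfun (apolar_form f).

Fact apolar_dual_is_linear : linear apolar_dual.
Proof.
move=> c f1 f2; apply/lfunP => g.
rewrite add_lfunE scale_lfunE !lfunE /= /apolar_form /apolar scaler_sumr.
rewrite -big_split /=; apply: eq_bigr => a _.
by rewrite linearP /= mulrDr mulrDl; congr (_ + _); rewrite mulrCA -!mulrA.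
Qed.
HB.instance Definition _ :=
  GRing.isLinear.Build R (hform R N d) 'Hom(hform R N d, R^o) _ apolar_dual
    apolar_dual_is_linear.

Definition apolar_iso : 'Hom(hform R N d, 'Hom(hform R N d, R^o)) :=
  linfun apolar_dual.

Fact apolar_iso_bij : (lker apolar_iso == 0%VS) && (limg apolar_iso == fullv).
Proof.
have coefgt0 (a : 'X_{1..N.+1}) : 0 < (multinomial_coeff a)^-1.
  rewrite invr_gt0 divr_gt0 ?ltr0n ?fact_gt0 //.
  by rewrite -natr_prod ltr0n prodn_gt0 // => i; rewrite fact_gt0.
have ker0 : lker apolar_iso == 0%VS.
  rewrite -subv0; apply/subvP => f; rewrite memv_ker memv0 lfunE /=.
  move=> /eqP/lfunP/(_ f).
  rewrite zero_lfunE lfunE /= /apolar_form /apolar => /eqP.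
  rewrite psumr_eq0 => [/allP f0|a _]; last first.
    by rewrite -mulrA mulr_ge0 ?(ltW (coefgt0 _)) // -expr2 sqr_ge0.
  apply/eqP/val_inj/mpolyP => a; rewrite mcoeff0.
  have [ad|ad] := eqVneq (mdeg a) d; last first.
    exact: dhomog_nemf_coeff (dhomog_is_dhomog f) ad.
  have la : (mdeg a < d.+1)%N by rewrite ad.
  have := f0 (BMultinom la) (mem_index_enum _); rewrite /= ad eqxx /=.
  by rewrite -mulrA mulf_eq0 gt_eqF //= -expr2 sqrf_eq0 => /eqP.
rewrite ker0 /= eqEdim subvf /= limg_dim_eq; last by rewrite (eqP ker0) capv0.
by rewrite !dimvf /dim /= muln1.
Qed.

End Apolar.

Section Transpose.
Variables (R : realType) (U V : vectType R) (w : 'Hom(U, V)).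

Definition lfun_tr_fun (l : 'Hom(V, R^o)) : 'Hom(U, R^o) := (l \o w)%VF.

Fact lfun_tr_fun_is_linear : linear lfun_tr_fun.
Proof. by move=> c l1 l2; rewrite /lfun_tr_fun comp_lfunDl comp_lfunZl. Qed.
HB.instance Definition _ :=
  GRing.isLinear.Build R 'Hom(V, R^o) 'Hom(U, R^o) _ lfun_tr_fun
    lfun_tr_fun_is_linear.

Definition lfun_tr : 'Hom('Hom(V, R^o), 'Hom(U, R^o)) := linfun lfun_tr_fun.

End Transpose.

Section QSymmetric.
Variables (R : realType) (m n h k : nat) (q : 'I_n.+1 -> hform R m h).

Definition q_tuple : n.+1.-tuple {mpoly R[m.+1]} :=
  [tuple (q i : {mpoly R[m.+1]}) | i < n.+1].

Fact q_comp_homog (p : hform R n k) : (p : {mpoly R[n.+1]}) \mPo q_tuple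
  \is (h * k)%N.-homog.
Proof.
rewrite comp_mpolyE big_seq; apply: rpred_sum => a ap; apply: rpredZ.
have <- : mdeg a = k := dhomog_mf (dhomog_is_dhomog p) ap.
rewrite mdegE big_distrr /=.
elim/big_rec2: _ => [|i d f _ hf]; first exact: dhomog1.
by rewrite dhomogM // tnth_mktuple dhomogMn // dhomog_is_dhomog.
Qed.

(* Substitution X_i := q_i(Z), that is, the linear map with
   'X_[a] |-> \prod_i q_i ^+ a i *)
Definition W_fun (p : hform R n k) : hform R m (h * k) :=
  DHomog (q_comp_homog p).

Fact W_fun_is_linear : linear W_fun.
Proof. by move=> c p1 p2; apply/val_inj; rewrite /= !linearP. Qed.
HB.instance Definition _ :=
  GRing.isLinear.Build R (hform R n k) (hform R m (h * k)) _ W_fun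
    W_fun_is_linear.

Definition W : 'Hom(hform R n k, hform R m (h * k)) := linfun W_fun.

(* [apolar_iso] is bijective by [apolar_iso_bij], so [^-1] is its inverse. *)
Definition phi : 'Hom(hform R m (h * k), hform R n k) :=
  ((apolar_iso R n k)^-1 \o lfun_tr W \o apolar_iso R m (h * k))%VF.

Definition q_sym : {vspace hform R n k} := limg phi.

Definition q_eval (xi : 'rV[R]_m.+1) : 'rV[R]_n.+1 :=
  \row_i (q i : {mpoly R[m.+1]}).@[fun j => xi 0 j].

Definition linear_form (v : 'rV[R]_n.+1) : {mpoly R[n.+1]} :=
  \sum_(i < n.+1) v 0 i *: 'X_i.

(* Same point of P^m(R), for representatives that are nonzero *)
Definition proj_eq (v w : 'rV[R]_m.+1) : Prop :=
  exists2 c : R, c != 0 & v = c *: w.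

Definition positive_q_decomposition (p : hform R n k) : Prop :=
  exists (r : nat) (lambda : 'I_r -> R) (xi : 'I_r -> 'rV[R]_m.+1),
  [/\ forall i, 0 < lambda i,
      forall i, xi i != 0,
      forall i j, i != j -> ~ proj_eq (xi i) (xi j)
    & (p : {mpoly R[n.+1]}) =
        \sum_(i < r) lambda i *: linear_form (q_eval (xi i)) ^+ k].

Definition positive_q_sym : set (hform R n k) :=
  [set p | p = 0 \/ (p \in q_sym /\ positive_q_decomposition p)].

End QSymmetric.

Definition dual_cone (R : realType) (V : Type) (ip : V -> V -> R) (C : set V) :
    set V :=
  [set v | forall w, C w -> 0 <= ip v w].

Definition unit_sphere (R : realType) (m : nat) : set 'rV[R]_m.+1 :=
  [set v | \sum_(i < m.+1) v 0 i ^+ 2 = 1].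

Arguments positive_q_sym {R m n h} k q.
Arguments q_sym {R m n h} k q.
Arguments phi {R m n h} k q.
Arguments W {R m n h} k q.
Arguments unit_sphere : clear implicits.

(* Main.v *)
Require Import Defs.
From mathcomp Require Import all_boot all_order all_algebra.
From mathcomp Require Import boolp classical_sets reals.
From mathcomp Require Import mpoly.

(** Apolar evaluation: <p, <v,X>^k> = p(v).  Hence phi sends <xi,Z>^(hk) to
    <q(xi),X>^k, so each <q(xi),X>^k is itself a positive q-symmetric tensor,
    and pairing with p against these generators is evaluation of p o q.  As
    p o q is homogeneous of even degree hk, its sign on nonzero vectors is
    determined on the unit sphere. *)

Set Implicit Arguments.
Unset Strict Implicit.
Unset Printing Implicit Defensive.

Import Order.TTheory GRing.Theory Num.Theory.

Local Open Scope classical_set_scope.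
Local Open Scope ring_scope.

Lemma linear_form_homog (R : realType) (N : nat) (v : 'rV[R]_N.+1) :
  linear_form v \is 1.-homog.
Proof.
apply: rpred_sum => i _; apply: rpredZ; rewrite dhomogX; exact/eqP/mdeg1.
Qed.

Fact linear_form_expr_homog (R : realType) (N d : nat) (v : 'rV[R]_N.+1) :
  linear_form v ^+ d \is d.-homog.
Proof. by have := dhomogMn d (linear_form_homog v); rewrite mul1n. Qed.

Definition power_form (R : realType) (N : nat) (d : nat) (v : 'rV[R]_N.+1) :
  hform R N d := DHomog (linear_form_expr_homog d v).

Lemma mderiv_linear_form (R : realType) (N : nat) (v : 'rV[R]_N.+1) i :
  (linear_form v)^`M(i) = (v 0 i)%:MP.
Proof.
rewrite /linear_form raddf_sum (bigD1 i) //= big1 => [|j ji]; last first.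
  by rewrite mderivZ mderivX mnm1E (negbTE ji) scale0r scaler0.
rewrite mderivZ mderivX mnm1E eqxx scale1r addr0.
(* The exponent left by differentiating ['X_i] is [U_(i) - U_(i)]; writing it as
   [(0 + U_(i)) - U_(i)] exposes it as 0. *)
by rewrite -{1}[U_(i)%MM]add0m addmK mpolyX0 alg_mpolyC.
Qed.

Lemma mderiv_linear_form_expr (R : realType) (N d : nat) (v : 'rV[R]_N.+1) i :
  (linear_form v ^+ d.+1)^`M(i) = (d.+1%:R * v 0 i) *: linear_form v ^+ d.
Proof.
elim: d => [|d IHd].
  by rewrite expr1 mderiv_linear_form expr0 mul1r alg_mpolyC.
rewrite exprS mderivM IHd mderiv_linear_form mul_mpolyC -scalerAr -exprS.
by rewrite -scalerDl -[in RHS]natr1 mulrDl mul1r addrC.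
Qed.

(** With [prod_expr_mnmDU], isolates how both sides of the multinomial theorem change when one
    exponent is raised; the factor [(a i).+1] is the one that differentiation brings out. *)
Lemma prod_fact_mnmDU (R : realType) (N : nat) (a : 'X_{1..N}) i :
  \prod_j ((a + U_(i))%MM j)`!%:R = (a i).+1%:R * \prod_j (a j)`!%:R :> R.
Proof.
rewrite (bigD1 i) //= [in RHS](bigD1 i) //= mnmDE mnm1E eqxx addn1 factS natrM.
rewrite mulrA; congr (_ * _); apply: eq_bigr => j ji.
by rewrite mnmDE mnm1E eq_sym (negbTE ji) addn0.
Qed.

Lemma prod_expr_mnmDU (R : realType) (N : nat) (v : 'I_N -> R)
    (a : 'X_{1..N}) i :
  \prod_j v j ^+ (a + U_(i))%MM j = v i * \prod_j v j ^+ a j.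
Proof.
rewrite (bigD1 i) //= [in RHS](bigD1 i) //= mnmDE mnm1E eqxx addn1 exprS mulrA.
congr (_ * _); apply: eq_bigr => j ji.
by rewrite mnmDE mnm1E eq_sym (negbTE ji) addn0.
Qed.

(* Multinomial theorem, by induction on the degree through
   d_i (l^(d+1)) = (d+1) v_i l^d. *)
Lemma mcoeff_linear_form_expr (R : realType) (N d : nat) (v : 'rV[R]_N.+1)
    (a : 'X_{1..N.+1}) : mdeg a = d ->
  (\prod_i (a i)`!%:R) * (linear_form v ^+ d)@_a =
    d`!%:R * \prod_i v 0 i ^+ a i.
Proof.
elim: d a => [|d IHd] a ad.
  have -> : a = 0%MM by apply/eqP; rewrite -mdeg_eq0 ad.
  rewrite expr0 mcoeff1 eqxx !big1 ?mulr1 // => i _; rewrite mnm0E //.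
have [i ai] : exists i, a i != 0.
  apply/existsP; apply: contra_eqT ad; rewrite negb_exists => /forallP a0.
  by rewrite mdegE big1 // => i _; apply/eqP; have := a0 i; rewrite negbK.
have Ui : (U_(i) <= a)%MM.
  by apply/mnm_lepP => j; rewrite mnm1E; case: eqP => // <-; rewrite lt0n.
move: ad; rewrite -(submK Ui); set b := (a - U_(i))%MM.
rewrite mdegD mdeg1 addn1 => -[bd].
(* Coefficients at [b] of the derivative identity: [b i + 1] times the coefficient at [b + U_(i)] is
   [(d+1) * v_i] times the one at [b]. *)
have := congr1 (mcoeff b) (mderiv_linear_form_expr d v i).
rewrite mcoeff_mderiv mcoeffZ -[LHS]mulr_natl => Hb.
rewrite prod_fact_mnmDU prod_expr_mnmDU mulrAC Hb.
rewrite -mulrA [_ * \prod_(_ < _) _]mulrC IHd // factS natrM.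
by rewrite -!mulrA; congr (_ * _); rewrite mulrCA.
Qed.

(** Puts evaluation over the index set of [apolar], so that the two compare term by term;
    homogeneity kills the coefficients in other degrees. *)
Lemma meval_hformE (R : realType) (N d : nat) (p : hform R N d)
    (v : 'I_N.+1 -> R) :
  (p : {mpoly R[N.+1]}).@[v] =
  \sum_(a : 'X_{1..N.+1 < d.+1} | mdeg a == d) p@_a * \prod_i v i ^+ a i.
Proof.
have szp : (msize (val p) <= d.+1)%N.
  rewrite msizeE; apply/bigmax_leqP_seq => a ap _.
  by rewrite (dhomog_mf (dhomog_is_dhomog p) ap).
rewrite {1}(mpolywE szp) raddf_sum /= [RHS]big_mkcond /=.
apply: eq_bigr => a _; rewrite mevalZ mevalX; case: ifPn => // ad.
by rewrite (dhomog_nemf_coeff (dhomog_is_dhomog p) ad) mul0r.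
Qed.

Lemma apolarC (R : realType) (N d : nat) (f g : hform R N d) :
  apolar f g = apolar g f.
Proof. by apply: eq_bigr => a _; rewrite mulrAC. Qed.

(** The inverse weight in [apolar] cancels the multinomial coefficient of each monomial of the
    power. *)
Lemma apolar_power_form (R : realType) (N d : nat) (p : hform R N d)
    (v : 'rV[R]_N.+1) :
  apolar p (power_form d v) = (p : {mpoly R[N.+1]}).@[fun i => v 0 i].
Proof.
rewrite meval_hformE; apply: eq_bigr => a /eqP ad /=.
rewrite mulrAC mulrC; congr (_ * _).
rewrite /multinomial_coeff invf_div mulrAC mcoeff_linear_form_expr //.
by rewrite mulrAC mulfV ?mul1r // pnatr_eq0 -lt0n fact_gt0.
Qed.

Lemma meval_hform_scale (R : realType) (N d : nat) (p : hform R N d)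
    (c : R) (v : 'I_N.+1 -> R) :
  (p : {mpoly R[N.+1]}).@[fun i => c * v i] =
  c ^+ d * (p : {mpoly R[N.+1]}).@[v].
Proof.
rewrite !meval_hformE mulr_sumr; apply: eq_bigr => a /eqP ad.
rewrite mulrCA; congr (_ * _).
have -> : c ^+ d = \prod_i c ^+ a i by rewrite prodrXr -mdegE ad.
rewrite -big_split /=.
by apply: eq_bigr => i _; rewrite exprMn.
Qed.

Section QSym.
Variables (R : realType) (m n h k : nat) (q : 'I_n.+1 -> hform R m h).

Lemma meval_W (p : hform R n k) (xi : 'rV[R]_m.+1) :
  (W k q p : {mpoly R[m.+1]}).@[fun j => xi 0 j] =
  (p : {mpoly R[n.+1]}).@[fun i => q_eval q xi 0 i].
Proof.
rewrite lfunE /= comp_mpoly_meval; apply: meval_eq => i.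
by rewrite tnth_mktuple mxE.
Qed.

Lemma phi_power_form (xi : 'rV[R]_m.+1) :
  phi k q (power_form (h * k) xi) = power_form k (q_eval q xi).
Proof.
have /andP[iso_inj _] := apolar_iso_bij R n k.
(* Both sides become [apolar_iso^-1] of a functional; on a form [p] these functionals give
   [(W p)(xi)] and [p(q(xi))]. *)
rewrite /phi !comp_lfunE -[RHS](lker0_lfunK iso_inj); congr (_ _).
apply/lfunP => p; rewrite [in RHS]lfunE /= lfunE /= comp_lfunE.
rewrite !lfunE /= /apolar_form apolarC apolar_power_form.
by rewrite apolarC apolar_power_form -meval_W lfunE.
Qed.

(** A single term of weight 1 is a decomposition, and [phi_power_form] puts it in the image of
    [phi]. *)
Lemma power_form_q_eval_positive (xi : 'rV[R]_m.+1) : xi != 0 ->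
  positive_q_sym k q (power_form k (q_eval q xi)).
Proof.
move=> xi0; right; split.
  by rewrite -phi_power_form memv_img // memvf.
exists 1%N, (fun=> 1), (fun=> xi); split=> //.
  by move=> i j; rewrite !ord1.
by rewrite big_ord1 scale1r.
Qed.

Lemma apolar_sum_power_form (p w : hform R n k) (r : nat) (lambda : 'I_r -> R)
    (v : 'I_r -> 'rV[R]_n.+1) :
  (w : {mpoly R[n.+1]}) = \sum_i lambda i *: linear_form (v i) ^+ k ->
  apolar p w =
    \sum_i lambda i * (p : {mpoly R[n.+1]}).@[fun j => v i 0 j].
Proof.
move=> wE.
have -> : w = \sum_i lambda i *: power_form k (v i).
  by apply: val_inj; rewrite [LHS]wE raddf_sum; apply: eq_bigr.
rewrite -[LHS]/(apolar_form p _) linear_sum; apply: eq_bigr => i _.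
by rewrite linearZ /= /apolar_form apolar_power_form.
Qed.

Lemma meval_q_eval_ge0 (p : hform R n k) : ~~ odd k ->
  (forall xi, unit_sphere R m xi ->
     0 <= (p : {mpoly R[n.+1]}).@[fun i => q_eval q xi 0 i]) ->
  forall xi, xi != 0 -> 0 <= (p : {mpoly R[n.+1]}).@[fun i => q_eval q xi 0 i].
Proof.
move=> k_even p_ge0 xi xi0.
set s := \sum_i xi 0 i ^+ 2.
have s_gt0 : 0 < s.
  rewrite lt_def sumr_ge0 ?andbT => [|i _]; last exact: sqr_ge0.
  (* A vanishing sum of squares would force every coordinate of [xi] to vanish. *)
  apply: contra_neq xi0 => /eqP; rewrite psumr_eq0 => [/allP s0|i _].
    apply/rowP => i; rewrite mxE; apply/eqP; rewrite -sqrf_eq0.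
    exact: s0 (mem_index_enum i).
  exact: sqr_ge0.
set c := Num.sqrt s.
have c0 : c != 0 by rewrite gt_eqF // sqrtr_gt0.
have : 0 <= (p : {mpoly R[n.+1]}).@[fun i => q_eval q (c^-1 *: xi) 0 i].
  apply: p_ge0; rewrite /unit_sphere /=.
  under eq_bigr do rewrite mxE exprMn.
  by rewrite -mulr_sumr exprVn sqr_sqrtr ?mulVf ?(ltW s_gt0) ?gt_eqF.
(* Seen through [W k q p], normalizing [xi] only multiplies the value by [c^-1 ^+ (h * k)], positive
   because [h * k] is even. *)
rewrite -!meval_W; under meval_eq do rewrite mxE.
rewrite meval_hform_scale pmulr_rge0 // exprn_even_gt0 ?invr_eq0 ?c0 ?orbT //.
by rewrite oddM negb_and k_even orbT.
Qed.

End QSym.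

Theorem theorem3p20 (R : realType) (m n k h : nat)
    (m_gt0 : (0 < m)%N) (n_gt0 : (0 < n)%N)
    (k_gt0 : (0 < k)%N) (h_gt0 : (0 < h)%N)
    (k_even : ~~ odd k) (q : 'I_n.+1 -> hform R m h) :
  dual_cone (@apolar R n k) (positive_q_sym k q) =
  [set p : hform R n k | forall xi : 'rV[R]_m.+1, unit_sphere R m xi ->
     0 <= (p : {mpoly R[n.+1]}).@[fun i => q_eval q xi 0 i]].
Proof.
apply/seteqP; split=> [p p_dual xi xi_unit|p p_ge0 w].
  (* The value at [xi] is the pairing of [p] with one generator of the cone; a unit vector is
     nonzero, so that generator is admissible. *)
  rewrite -apolar_power_form; apply/p_dual/power_form_q_eval_positive.
  apply: contra_eq_neq xi_unit => ->; rewrite big1 => [|i _].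
    by rewrite eq_sym oner_neq0.
  by rewrite mxE expr0n.
case=> [->|[_ [r [lambda [xi [lambda_gt0 xi0 _ wE]]]]]].
  by rewrite -[apolar _ _]/(apolar_form p 0) linear0.
(* The pairing is a combination, with positive weights, of values of [p] at points [q(xi i)] with
   [xi i] nonzero. *)
rewrite (apolar_sum_power_form p wE) sumr_ge0 // => i _.
by rewrite mulr_ge0 ?(ltW (lambda_gt0 i)) // meval_q_eval_ge0.
Qed.
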